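(* For every graph $G$ with maximum degree $\Delta$, $$\pi_{\mathrm{ch}}(G)\le (1+o(1))\,\Delta^2,$$ where $o(1)$ denotes a quantity depending only on $\Delta$ that tends to $0$ as $\Delta\to\infty$. That is, for every $\eta>0$ there is an integer $\Delta_0$ such that every graph $G$ with maximum degree $\Delta\ge\Delta_0$ satisfies $\pi_{\mathrm{ch}}(G)\le(1+\eta)\Delta^2$.
   Context: All graphs are simple, finite and undirected. A path is even if its number of vertices is even. Given a vertex colouring $\psi$ of $G$, an even path $v_1,\dots,v_{2t}$ ($t\ge1$) of $G$ (a subgraph, not necessarily induced) is repetitively coloured by $\psi$ if $\psi(v_i)=\psi(v_{t+i})$ for all $i\in\{1,\dots,t\}$. A colouring is nonrepetitive if no path of $G$ is repetitively coloured. A list assignment $L$ of $G$ assigns a set $L(v)$ of colours to each vertex $v$; $G$ is nonrepetitively $L$-colourable if it has a nonrepetitive colouring in which each vertex $v$ receives a colour in $L(v)$. $G$ is nonrepetitively $\ell$-choosable if it is nonrepetitively $L$-colourable for every list assignment $L$ with $|L(v)|\ge\ell$ for all $v\in V(G)$. The nonrepetitive choice number $\pi_{\mathrm{ch}}(G)$ is the minimum integer $\ell$ such that $G$ is nonrepetitively $\ell$-choosable. *)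

(* Defs.v *)
From mathcomp Require Import all_boot.
From mathcomp Require Import boolp classical_sets functions cardinality.

Set Implicit Arguments.
Unset Strict Implicit.
Unset Printing Implicit Defensive.

Local Open Scope classical_set_scope.
Local Open Scope card_scope.

Record sgraph := SGraph {
  vertex :> finType;
  edge : rel vertex;
  edge_sym : symmetric edge;
  edge_irrefl : irreflexive edge
}.

Definition degree (G : sgraph) (v : G) : nat := #|[pred w | edge v w]|.

Definition max_degree (G : sgraph) : nat := \max_(v : G) degree v.

(* The list [p] of vertices v_1, ..., v_m is a path of [G], as a subgraph:
   [G] may have further edges between the v_i. *)
Definition is_path (G : sgraph) (p : seq G) : bool :=
  sorted (@edge G) p && uniq p.

(* Indices are shifted to start at 0. *)
Definition repetitively_coloured (V : eqType) (C : Type) (psi : V -> C)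
    (p : seq V) : Prop :=
  exists t : nat, [/\ (0 < t)%N, size p = (2 * t)%N &
    forall (x0 : V) (i : nat), (i < t)%N ->
      psi (nth x0 p i) = psi (nth x0 p (t + i))].

Definition nonrepetitive (G : sgraph) (C : Type) (psi : G -> C) : Prop :=
  forall p : seq G, is_path p -> ~ repetitively_coloured psi p.

Definition nonrep_list_colourable (G : sgraph) (C : Type) (L : G -> set C) :
    Prop :=
  exists psi : G -> C, nonrepetitive psi /\ forall v : G, L v (psi v).

(* [`I_l #<= L v] says that the (possibly infinite) set [L v] has at least [l]
   elements. *)
Definition nonrep_choosable (G : sgraph) (l : nat) : Prop :=
  forall (C : Type) (L : G -> set C),
    (forall v : G, `I_l #<= L v) -> nonrep_list_colourable L.

(* Any injective colouring is nonrepetitive, so lists of size [#|G|] suffice;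
   this makes the minimum defining [pi_ch] below well defined. *)
Lemma injective_nonrepetitive (G : sgraph) (C : Type) (psi : G -> C) :
  injective psi -> nonrepetitive psi.
Proof.
move=> inj p /andP[_ up] [t [t0 sp H]].
case: p up sp H => [|x0 p] up sp H; first by rewrite /= in sp; case: t t0 sp H.
have := inj _ _ (H x0 0%N t0); rewrite addn0 => /eqP.
rewrite nth_uniq ?sp ?muln_gt0 //; last by rewrite mul2n -addnn -{1}(addn0 t) ltn_add2l.
by rewrite eq_sym eqn0Ngt t0.
Qed.

Lemma card_le_ord (C : Type) (A : set C) (l : nat) : `I_l #<= A ->
  exists g : 'I_l -> C, injective g /\ forall i, A (g i).
Proof.
move=> /card_leP[f].
exists (fun i : 'I_l => set_val (f (SigSub (mem_set (ltn_ord i : `I_l i))))).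
split=> [i j /val_inj e|i]; last exact: set_valP.
have := @inj _ _ _ f _ _ (mem_set I) (mem_set I) e.
by move=> /(congr1 val) /= /val_inj.
Qed.

Lemma card_le_fresh (V : finType) (C : Type) (psi : V -> C) (s : seq V)
    (A : set C) (l : nat) :
  (size s < l)%N -> `I_l #<= A ->
  exists c, A c /\ forall w, w \in s -> psi w <> c.
Proof.
move=> sl /card_le_ord[g [g_inj gA]].
apply: contrapT => no.
have /choice[h hP] : forall i : 'I_l, exists w, w \in s /\ psi w = g i.
  move=> i; apply: contrapT => noi; apply: no; exists (g i); split=> //.
  by move=> w ws e; apply: noi; exists w.
have h_inj : injective h.
  by move=> i j e; apply: g_inj; rewrite -(hP i).2 -(hP j).2 e.
have : (size (codom h) <= size s)%N.
  apply: uniq_leq_size; first by rewrite map_inj_uniq ?enum_uniq.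
  by move=> _ /codomP[i ->]; case: (hP i).
by rewrite size_codom card_ord leqNgt sl.
Qed.

Lemma nonrep_choosable_card (G : sgraph) : nonrep_choosable G #|G|.
Proof.
move=> C L HL.
case: (pickP (@predT G)) => [v0 _|V0]; last first.
  have F (v : G) : False by have := V0 v.
  exists (fun v => False_rect C (F v)); split; last by move=> v; case: (F v).
  by apply: injective_nonrepetitive => v; case: (F v).
have G0 : (0 < #|G|)%N by apply/card_gt0P; exists v0.
have [g _] := card_le_ord (HL v0); pose c0 := g (Ordinal G0).
suff /(_ (enum G)) [] : forall s : seq G, uniq s -> exists psi : G -> C,
    {in s &, injective psi} /\ forall v, v \in s -> L v (psi v).
- exact: enum_uniq.
- move=> psi [psi_inj psiL]; exists psi; split.
    by apply: injective_nonrepetitive => u v; apply: psi_inj; rewrite mem_enum.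
  by move=> v; apply: psiL; rewrite mem_enum.
elim=> [|v s IH] /=; first by exists (fun=> c0).
case/andP=> vs us; have [psi [psi_inj psiL]] := IH us.
have sG : (size s < #|G|)%N.
  have /card_uniqP e : uniq (v :: s) by rewrite /= vs us.
  by rewrite -[X in (X <= _)%N]e max_card.
have [c [Lc fresh]] := card_le_fresh psi sG (HL v).
exists (fun w => if w == v then c else psi w); split.
  move=> a b; rewrite !inE.
  case: (eqVneq a v) => [->|_]; case: (eqVneq b v) => [->|_] //=.
  - by move=> _ bs e; case: (fresh b bs).
  - by move=> as_ _ e; case: (fresh a as_).
  - exact: psi_inj.
by move=> w; rewrite inE; case: (eqVneq w v) => [->|_] //=; exact: psiL.
Qed.

Lemma ex_nonrep_choosable (G : sgraph) : exists l, `[< nonrep_choosable G l >].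
Proof. by exists #|G|; apply/asboolP; exact: nonrep_choosable_card. Qed.

Definition pi_ch (G : sgraph) : nat := ex_minn (ex_nonrep_choosable G).

(* Main.v *)
Require Import Defs.
From mathcomp Require Import all_boot all_order all_algebra reals.
From mathcomp Require Import boolp zify ring lra.

Set Implicit Arguments.
Unset Strict Implicit.
Unset Printing Implicit Defensive.

Import Order.TTheory GRing.Theory Num.Theory.

(** The proof is Rosenfeld's counting argument. Write N(S) for the number of
list colourings of the vertex set S that are nonrepetitive on S, when all lists
have size l, and D for the maximum degree. Instead of showing only N(S) > 0,
one shows by induction that adding a vertex multiplies N by at least a fixed
beta > 0: N(S + v) >= beta N(S) whenever v is not in S
([colourings_growth]).

A nonrepetitive colouring of S has l extensions to S + v ([card_extensions]).
A failing extension makes some path p on 2(t + 1) vertices repetitive, and p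
goes through v; reversing p if necessary, v lies in its first half H
([extensions_cover]). The second half of p then dictates the colours on H, so
an extension that fails because of p is determined by its restriction to
(S + v) \ H, which is nonrepetitive there ([card_repetitive_extensions]). This
set is S with t vertices removed, so the induction hypothesis bounds the number
of such extensions by N(S) / beta^t. There are at most (t + 1) D^(2t + 1)
choices of p ([size_half_paths]). Hence

  N(S + v) >= (l - sum_t (t + 1) D^(2t + 1) / beta^t) N(S),

and the induction goes through as soon as beta plus this sum is at most l
([nonrep_choosable_of_sum]). For beta = (1 + eta/2) D^2 the sum is D times an
arithmetico-geometric sum of ratio 1 / (1 + eta/2), so it is O(D) for fixed eta
([sum_arith_geometric]); it fits into the gap (eta/2) D^2 between beta and
(1 + eta) D^2 once D is large. *)

(** * Counting along sequences *)

Lemma size_flatten_map_le (A B : Type) (f : A -> seq B) (s : seq A) (m : nat) :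
  (forall x, size (f x) <= m) -> size (flatten (map f s)) <= size s * m.
Proof.
move=> fm; elim: s => //= x s IH.
by rewrite size_cat mulSn leq_add.
Qed.

Lemma card_cover_seq (A : finType) (I : eqType) (s : seq I) (F : I -> {set A})
    (X : {set A}) :
  (forall x, x \in X -> exists2 i, i \in s & x \in F i) ->
  #|X| <= \sum_(i <- s) #|F i|.
Proof.
elim: s X => [|i s IH] X cover.
  by rewrite big_nil leqn0 cards_eq0; apply/set0Pn => -[x /cover[]].
rewrite big_cons -(cardsID (F i) X) leq_add ?subset_leq_card ?subsetIr//.
apply: IH => x /setDP[/cover[j]]; rewrite inE => /orP[/eqP->|js] xF xi.
  by rewrite xF in xi.
by exists j.
Qed.

(** * Paths with a given vertex in their first half *)

Lemma degree_le_max (G : sgraph) (v : G) : degree v <= max_degree G.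
Proof. exact: leq_bigmax. Qed.

(** The starting vertex [v] is left out of the listed sequences, as in the
convention of [path]. *)
Fixpoint walks (G : sgraph) (n : nat) (v : G) : seq (seq G) :=
  if n is n'.+1
  then flatten [seq [seq w :: s | s <- walks n' w] | w <- enum (edge v)]
  else [:: [::]].

Lemma mem_walks (G : sgraph) (v : G) (s : seq G) :
  path (@edge G) v s -> s \in walks (size s) v.
Proof.
elim: s v => //= w s IH v /andP[vw ps].
apply/flatten_mapP; exists w; first by rewrite mem_enum.
by rewrite map_f ?IH.
Qed.

Lemma size_walks (G : sgraph) (n : nat) (v : G) :
  size (walks n v) <= max_degree G ^ n.
Proof.
elim: n v => //= n IH v; rewrite expnS.
apply: leq_trans (leq_mul (degree_le_max v) (leqnn _)).
rewrite /degree cardE; apply: size_flatten_map_le => w.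
by rewrite size_map.
Qed.

(** Walking from [v] towards the start and towards the end of the path, [i] and
[2t + 1 - i] steps respectively, gives an enumeration whose length is easy to
bound; the filter leaves exactly the paths of interest ([mem_half_paths]). *)
Definition half_paths (G : sgraph) (v : G) (t : nat) : seq (seq G) :=
  [seq p <- flatten [seq [seq rev a ++ v :: b | a <- walks i v,
                                               b <- walks (t.*2.+1 - i) v]
                    | i <- iota 0 t.+1]
  | [&& is_path p, size p == t.+1.*2 & v \in take t.+1 p]].

Lemma is_path_rev (G : sgraph) (p : seq G) : is_path (rev p) = is_path p.
Proof.
rewrite /is_path rev_uniq rev_sorted; congr andb.
by apply: eq_sorted => x y; rewrite edge_sym.
Qed.

Lemma mem_half_paths (G : sgraph) (v : G) (t : nat) (p : seq G) :
  (p \in half_paths v t) =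
  [&& is_path p, size p == t.+1.*2 & v \in take t.+1 p].
Proof.
rewrite mem_filter; apply: andb_idr => /and3P[path_p /eqP sp vp].
have vip := mem_take vp; rewrite in_take // in vp.
case/splitPr: vip path_p sp vp => a b path_p sp vp.
have va : v \notin a.
  by case/andP: path_p => _; rewrite cat_uniq /= negb_or => /and3P[_ /andP[]].
move: vp; rewrite index_cat (negbTE va) index_head addn0 => lt_a.
apply/flatten_mapP; exists (size a); first by rewrite mem_iota.
have /andP[/cat_sorted2[_ path_b] _] := path_p.
have := path_p; rewrite -is_path_rev rev_cat rev_cons cat_rcons.
case/andP => /cat_sorted2[_ path_a] _.
rewrite -[X in X ++ _]revK; apply: allpairs_f.
  by rewrite -size_rev; exact: mem_walks.
rewrite size_cat /= doubleS addnS in sp; case: sp => sp.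
by rewrite -sp addKn; exact: mem_walks.
Qed.

(** There are [t + 1] positions for [v], and at most [max_degree G] choices for
each of the other [2t + 1] vertices. *)
Lemma size_half_paths (G : sgraph) (v : G) (t : nat) :
  size (half_paths v t) <= t.+1 * max_degree G ^ t.*2.+1.
Proof.
rewrite size_filter; apply: leq_trans (count_size _ _) _.
rewrite -[X in _ <= X * _](size_iota 0).
have -> : iota 0 t.+1 = [seq val i | i <- enum 'I_t.+1] by rewrite val_enum_ord.
rewrite -map_comp size_map; apply: size_flatten_map_le => i /=.
rewrite size_allpairs.
have le_i : i <= t.*2.+1 by have := ltn_ord i; lia.
by rewrite -[X in _ <= _ ^ X](subnKC le_i) expnD leq_mul ?size_walks.
Qed.

Lemma repetitively_coloured_rev (V : eqType) (C : Type) (psi : V -> C)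
    (p : seq V) :
  repetitively_coloured psi p -> repetitively_coloured psi (rev p).
Proof.
case=> t [t_gt0 sp rep]; exists t; rewrite size_rev; split=> // x0 i it.
rewrite !nth_rev ?sp; try lia.
have -> : 2 * t - i.+1 = t + (t - i.+1) by lia.
have -> : 2 * t - (t + i).+1 = t - i.+1 by lia.
by rewrite -rep //; lia.
Qed.

(** * Nonrepetitive colourings of a vertex set *)

Section Colourings.

Variables (G : sgraph) (C : Type) (l : nat) (g : G -> 'I_l.+1 -> C).
Hypothesis g_inj : forall v, injective (g v).

Implicit Types (S T H : {set G}) (phi : {ffun G -> 'I_l.+1}).

Definition colour phi (v : G) : C := g v (phi v).

Definition nonrepetitive_on S phi : bool :=
  `[< forall p : seq G, is_path p -> {subset p <= S} ->
      ~ repetitively_coloured (colour phi) p >].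

(** A colouring of [S] is encoded as a map on all of [G] with the dummy value
[ord0] off [S], so that restricting to a subset of [S] is erasing values and
all the colourings counted live in a single finite type. *)
Definition vanishes_off S phi : bool :=
  [forall v, (v \notin S) ==> (phi v == ord0)].

Definition colourings S : {set {ffun G -> 'I_l.+1}} :=
  [set phi | vanishes_off S phi && nonrepetitive_on S phi].

Definition extensions (v : G) S : {set {ffun G -> 'I_l.+1}} :=
  [set phi | vanishes_off (v |: S) phi && nonrepetitive_on S phi].

Lemma vanishes_offP S phi :
  reflect (forall v, v \notin S -> phi v = ord0) (vanishes_off S phi).
Proof. by apply: (iffP 'forall_implyP) => h v vS; apply/eqP/h. Qed.

Lemma nonrepetitive_on_sub S T phi phi' :
  T \subset S -> {in T, phi =1 phi'} -> nonrepetitive_on S phi ->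
  nonrepetitive_on T phi'.
Proof.
move=> /subsetP TS eq_phi /asboolP nr; apply/asboolP => p path_p pT.
case=> t [t_gt0 sp rep]; apply: (nr p path_p) => [x /pT/TS //|].
exists t; split=> // x0 i it; rewrite /colour !eq_phi; first exact: rep.
  by apply/pT/mem_nth; lia.
by apply/pT/mem_nth; lia.
Qed.

Lemma card_extensions v S : v \notin S ->
  l.+1 * #|colourings S| <= #|extensions v S|.
Proof.
move=> vS.
pose extend (x : {ffun G -> 'I_l.+1} * 'I_l.+1) : {ffun G -> 'I_l.+1} :=
  [ffun w => if w == v then x.2 else x.1 w].
have offv w : w \in S -> w == v = false.
  by move=> wS; apply: contraNF vS => /eqP <-.
have -> : l.+1 * #|colourings S| = #|setX (colourings S) [set: 'I_l.+1]|.
  by rewrite cardsX cardsT card_ord mulnC.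
rewrite -(@card_in_imset _ _ extend); last first.
  move=> [phi c] [phi' c']; rewrite !inE /= !andbT.
  move=> /andP[/vanishes_offP off _] /andP[/vanishes_offP off' _] /ffunP eq_ext.
  have := eq_ext v; rewrite !ffunE eqxx /= => ->; congr pair.
  apply/ffunP => w; have := eq_ext w; rewrite !ffunE /=.
  by case: eqP => // -> _; rewrite off ?off'.
apply/subset_leq_card/subsetP => _ /imsetP[[phi c] /setXP[+ _] ->].
rewrite !inE => /andP[/vanishes_offP off nr]; apply/andP; split.
  apply/vanishes_offP => w; rewrite !inE negb_or ffunE => /andP[/negbTE -> /=].
  exact: off.
by apply: nonrepetitive_on_sub nr => // w wS; rewrite ffunE offv.
Qed.

Definition repetitive_extensions (v : G) S (p : seq G) :=
  [set phi in extensions v S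
  | all (mem (v |: S)) p && `[< repetitively_coloured (colour phi) p >]].

(** On a repetitively coloured path each vertex of the first half has the colour
of its partner in the second half, so erasing the first half loses no
information. What remains is nonrepetitive since [v] is among the erased
vertices. *)
Lemma card_repetitive_extensions v S t (p : seq G) : v \notin S ->
  p \in half_paths v t ->
  #|repetitive_extensions v S p|
    <= #|colourings ((v |: S) :\: [set x in take t.+1 p])|.
Proof.
move=> vS; rewrite mem_half_paths => /and3P[/andP[_ uniq_p] /eqP sp vp].
set H := [set x in _].
pose erase phi : {ffun G -> 'I_l.+1} :=
  [ffun x => if x \in H then ord0 else phi x].
(* [erase] is injective on the extensions for which [p] is repetitive. *)
rewrite -(@card_in_imset _ _ erase); last first.
  move=> phi phi'; rewrite !inE => /and3P[_ _ /asboolP[s [_ ss rep]]].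
  move=> /and3P[_ _ /asboolP[s' [_ ss' rep']]] /ffunP eq_erase.
  rewrite sp in ss ss'.
  have es : s = t.+1 by lia.
  have es' : s' = t.+1 by lia.
  subst s s'.
  have eq_off x : x \notin H -> phi x = phi' x.
    by move=> xH; have := eq_erase x; rewrite !ffunE (negbTE xH).
  apply/ffunP => x; case: (boolP (x \in H)) => [|/eq_off//].
  have st : size (take t.+1 p) = t.+1 by rewrite size_takel //; lia.
  rewrite inE => /(nthP v)[i]; rewrite st => it; rewrite nth_take // => <-.
  apply: (@g_inj (nth v p i)).
  rewrite -/(colour phi _) -/(colour phi' _) rep // rep' //.
  (* The partner [p_(t+1+i)] is not in [H] since the vertices of [p] are
     distinct, so both colourings agree on it. *)
  rewrite /colour eq_off // inE in_take ?mem_nth ?index_uniq ?sp //; lia.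
apply/subset_leq_card/subsetP => _ /imsetP[phi + ->].
rewrite !inE => /andP[/andP[/vanishes_offP off nr] _]; apply/andP; split.
  apply/vanishes_offP => x; rewrite !inE ffunE negb_and negbK inE.
  by case: ifP => //= _ xS; apply: off; rewrite !inE.
apply: nonrepetitive_on_sub nr => [|x]; last first.
  by rewrite ffunE inE => /andP[/negbTE ->].
apply/subsetP => x; rewrite !inE => /andP[xH /orP[/eqP xv|//]].
by rewrite xv vp in xH.
Qed.

(** A repetitive path in [v |: S] goes through [v], because the extension is
nonrepetitive on [S]. Reversal preserves repetitiveness, so [v] may be taken in
the first half. *)
Lemma extensions_cover v S :
  #|extensions v S| <= #|colourings (v |: S)| +
    \sum_(0 <= t < #|G|) \sum_(p <- half_paths v t)
      #|repetitive_extensions v S p|.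
Proof.
rewrite -(cardsID (colourings (v |: S))) leq_add ?subset_leq_card ?subsetIr //.
have -> : \sum_(0 <= t < #|G|)
    \sum_(p <- half_paths v t) #|repetitive_extensions v S p| =
  \sum_(p <- flatten [seq half_paths v t | t <- index_iota 0 #|G|])
    #|repetitive_extensions v S p| by rewrite big_flatten big_map.
apply: card_cover_seq => phi /setDP[ext_phi].
have := ext_phi; rewrite !inE => /andP[-> /asboolP nr] /= /asboolP rep_phi.
have [p [path_p pS rep]] : exists p, [/\ is_path p, {subset p <= v |: S} &
    repetitively_coloured (colour phi) p].
  apply: contrapT => no; apply: rep_phi => p path_p pS rep.
  by apply: no; exists p.
have vp : v \in p.
  apply: contrapT => vp; apply: (nr p path_p _ rep) => x xp.
  by have := pS x xp; rewrite !inE => /predU1P[xv|//]; rewrite -xv in vp.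
have [[|t] [t_gt0 sp _]] := rep; first by [].
have tG : t < #|G|.
  have /andP[_ /card_uniqP card_p] := path_p.
  have : size p <= #|G| by rewrite -card_p max_card.
  by apply: leq_trans; rewrite sp; lia.
have ht : {in half_paths v t, forall q, q \in
    flatten [seq half_paths v t | t <- index_iota 0 #|G|]}.
  by move=> q qt; apply/flatten_mapP; exists t => //; rewrite mem_index_iota.
have := vp; rewrite -{1}(cat_take_drop t.+1 p) mem_cat => /orP[vh|vh].
  exists p; last first.
    rewrite inE ext_phi /=; apply/andP; split; last exact/asboolP.
    exact/allP.
  by apply: ht; rewrite mem_half_paths path_p vh andbT sp; apply/eqP; lia.
exists (rev p); last first.
  rewrite inE ext_phi /=; apply/andP; split.
    by apply/allP => x; rewrite mem_rev; exact: pS.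
  exact/asboolP/repetitively_coloured_rev.
apply: ht; rewrite mem_half_paths is_path_rev path_p size_rev take_rev sp.
have -> : 2 * t.+1 - t.+1 = t.+1 by lia.
by rewrite mem_rev vh andbT; apply/eqP; lia.
Qed.

Local Open Scope ring_scope.

(** Adding one vertex multiplies the number of colourings by at least [beta].
The induction needs this for any number of added vertices: a path on
[2(t + 1)] vertices costs its first half, that is [v] and [t] vertices of
[S]. *)
Lemma colourings_growth (F : realFieldType) (beta : F) : 0 < beta ->
  beta + \sum_(0 <= t < #|G|)
    (t.+1 * max_degree G ^ t.*2.+1)%:R / beta ^+ t <= l.+1%:R ->
  forall S T, T \subset S ->
  beta ^+ #|S :\: T| * #|colourings T|%:R <= #|colourings S|%:R.
Proof.
move=> beta_gt0 le_l S.
have [n] := ubnP #|S|; elim: n S => // n IH S0 Sn T TS.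
have [/eqP|] := eqVneq (S0 :\: T) set0.
  rewrite setD_eq0 => ST; have -> : T = S0 by apply/eqP; rewrite eqEsubset TS.
  by rewrite setDv cards0 expr0 mul1r.
case/set0Pn => v /setDP[vS vT].
have [S defS vS'] : exists2 S, S0 = v |: S & v \notin S.
  by exists (S0 :\ v); rewrite ?setD1K // !inE eqxx.
subst S0.
have TS' : T \subset S.
  apply/subsetP => x xT; have := subsetP TS x xT; rewrite !inE.
  by case/predU1P => // xv; rewrite -xv xT in vT.
have Sn' : (#|S| < n)%N by move: Sn; rewrite cardsU1 vS'; lia.
have -> : #|(v |: S) :\: T| = #|S :\: T|.+1.
  have -> : (v |: S) :\: T = v |: (S :\: T).
    apply/setP => x; rewrite !inE; case: eqP => //= ->.
    by rewrite (negbTE vT).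
  by rewrite cardsU1 !inE (negbTE vS') andbF.
rewrite exprS -mulrA; apply: le_trans (_ : beta * #|colourings S|%:R <= _).
  by rewrite ler_pM2l // IH.
(* It remains to add the single vertex [v] to [S]. *)
have bound_rep t p : p \in half_paths v t ->
    #|repetitive_extensions v S p|%:R <= #|colourings S|%:R / beta ^+ t :> F.
  move=> pt; rewrite ler_pdivlMr ?exprn_gt0 //.
  have [->|[phi]] := set_0Vmem (repetitive_extensions v S p).
    by rewrite cards0 mul0r.
  rewrite inE => /and3P[_ /allP pS _].
  have /le_trans-> // : #|repetitive_extensions v S p|%:R * beta ^+ t <=
    #|colourings ((v |: S) :\: [set x in take t.+1 p])|%:R * beta ^+ t.
    rewrite ler_pM2r ?exprn_gt0 // ler_nat.
    exact: card_repetitive_extensions.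
  set H := [set x in _].
  have := pt; rewrite mem_half_paths => /and3P[/andP[_ up] /eqP sp vp].
  have HS : H \subset v |: S.
    by apply/subsetP => x; rewrite inE => /mem_take/pS.
  have cH : #|H| = t.+1.
    rewrite cardsE (card_uniqP _) ?take_uniq // size_takel //; lia.
  have sub : (v |: S) :\: H \subset S.
    apply/subsetP => x; rewrite !inE => /andP[xH /predU1P[xv|//]].
    by rewrite xv vp in xH.
  have -> : t = #|S :\: ((v |: S) :\: H)|.
    have -> : S :\: ((v |: S) :\: H) = H :\ v.
      apply/setP => x; rewrite !inE.
      case: (eqVneq x v) => [->|xv] /=; first by rewrite (negbTE vS') andbF.
      case xH : (x \in take t.+1 p) => /=; last by rewrite andNb.
      by have := subsetP HS x; rewrite !inE xH (negbTE xv) /= => ->.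
    by move: cH; rewrite (cardsD1 v) inE vp; lia.
  by rewrite mulrC; apply: IH.
have := leq_trans (card_extensions vS') (extensions_cover v S).
rewrite -(ler_nat F) natrD natrM natr_sum => count.
rewrite -(lerD2r (\sum_(0 <= t < #|G|)
  (t.+1 * max_degree G ^ t.*2.+1)%:R / beta ^+ t * #|colourings S|%:R)).
rewrite -[X in _ + X <= _]mulr_suml -mulrDl.
apply: le_trans (_ : l.+1%:R * #|colourings S|%:R <= _).
  by rewrite ler_wpM2r.
apply: le_trans count _; rewrite lerD2l; apply: ler_sum => t _.
rewrite natr_sum.
apply: le_trans (_ : (size (half_paths v t))%:R *
    (#|colourings S|%:R / beta ^+ t) <= _).
  rewrite mulr_natl -iter_addr_0 -count_predT -big_const_seq.
  by rewrite big_seq [leRHS]big_seq; apply: ler_sum => p; exact: bound_rep.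
rewrite mulrAC -mulrA ler_wpM2r // ?divr_ge0 ?exprn_ge0 // ?(ltW beta_gt0) //.
by rewrite ler_nat size_half_paths.
Qed.

End Colourings.

Local Open Scope ring_scope.

(** * Choice of parameters *)

(** Multiplied by [(1 - q)^2] the sum telescopes to
[1 - q^n (1 + n (1 - q))]. *)
Lemma sum_arith_geometric (F : realFieldType) (q : F) (n : nat) :
  0 <= q < 1 -> \sum_(0 <= t < n) t.+1%:R * q ^+ t <= (1 - q) ^- 2.
Proof.
case/andP=> q_ge0 q_lt1.
have q1 : 0 < 1 - q by rewrite subr_gt0.
rewrite -[leRHS]mul1r ler_pdivlMr ?exprn_gt0 //.
have -> : (\sum_(0 <= t < n) t.+1%:R * q ^+ t) * (1 - q) ^+ 2 =
    1 - q ^+ n * (1 + n%:R * (1 - q)).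
  elim: n => [|n IH]; first by rewrite big_nil mul0r mul0r addr0 mulr1 subrr.
  by rewrite big_nat_recr //= mulrDl IH (exprS q) -!natr1; ring.
by rewrite gerBl mulr_ge0 ?exprn_ge0 // addr_ge0 // mulr_ge0 // ltW.
Qed.

(** From the empty set, which has exactly one colouring, growth by positive
factors leads to a colouring of the whole graph. *)
Lemma nonrep_choosable_of_sum (F : realFieldType) (G : sgraph) (l : nat)
    (beta : F) : 0 < beta ->
  beta + \sum_(0 <= t < #|G|)
    (t.+1 * max_degree G ^ t.*2.+1)%:R / beta ^+ t <= l%:R ->
  nonrep_choosable G l.
Proof.
(* The hypothesis rules out [l = 0], which leaves a dummy value [ord0]. *)
move=> beta_gt0; case: l => [|l] le_l C L HL.
  have := lt_le_trans beta_gt0 (le_trans _ le_l); rewrite lerDl ltxx.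
  move=> /(_ _)/notF[]; apply: sumr_ge0 => t _.
  by rewrite divr_ge0 // exprn_ge0 // ltW.
have /choice[g gP] : forall v, exists gv : 'I_l.+1 -> C,
    injective gv /\ forall i, L v (gv i).
  by move=> v; exact: card_le_ord.
have g_inj v : injective (g v) by case: (gP v).
have := colourings_growth g_inj beta_gt0 le_l (sub0set [set: G]).
have /card_gt0P : exists phi, phi \in colourings g set0.
  exists [ffun=> ord0]; rewrite inE; apply/andP; split.
    by apply/vanishes_offP => v _; rewrite ffunE.
  apply/asboolP => -[|x p] _ p0; last first.
    by have := p0 x (mem_head _ _); rewrite inE.
  by case=> -[|t] [].
rewrite -(ltr_nat F) => c0 growth.
have /card_gt0P[phi] : (0 < #|colourings g [set: G]|)%N.
  rewrite -(ltr_nat F); apply: lt_le_trans growth.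
  by rewrite mulr_gt0 ?exprn_gt0.
rewrite inE => /andP[_ /asboolP nr].
exists (colour g phi); split=> [p path_p|v].
  by apply: nr => // x; rewrite inE.
by case: (gP v) => _; apply.
Qed.

Theorem theorem1 (R : realType) (eta : R) (eta_gt0 : 0 < eta) :
  exists Delta0 : nat, forall G : sgraph,
    (Delta0 <= max_degree G)%N ->
    (pi_ch G)%:R <= (1 + eta) * (max_degree G)%:R ^+ 2 :> R.
Proof.
pose q := (1 + eta / 2)^-1.
have e1 : 0 < 1 + eta / 2 by lra.
have q01 : 0 <= q < 1.
  by rewrite /q invr_ge0 (ltW e1) /= invf_lt1 //; lra.
(* The sum is at most [(K - 1) D]; the additional [1] in [K] absorbs the
   rounding of [(1 + eta) D^2] to an integer, since [1 <= D]. Then [K D] is at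
   most [(eta / 2) D^2] when [D] exceeds [2 K / eta]. *)
pose K := (1 - q) ^- 2 + 1.
have K_gt0 : 0 < K.
  by rewrite ltr_wpDl // invr_ge0 exprn_ge0 //; lra.
exists (Num.truncn (2 * K / eta)).+1 => G leD.
set D := max_degree G in leD *.
have D_gt : 2 * K / eta < D%:R.
  by apply: lt_le_trans (truncnS_gt _) _; rewrite ler_nat.
have D_ge1 : 1 <= D%:R :> R by rewrite ler1n; apply: leq_trans leD.
set B := (1 + eta) * _.
have B_ge0 : 0 <= B by rewrite mulr_ge0 ?exprn_ge0 //; lra.
apply: le_trans (_ : (Num.truncn B)%:R <= B); last by rewrite truncn_le.
rewrite ler_nat /pi_ch; case: ex_minnP => m _; apply; apply/asboolP.
have D2 : 0 < D%:R ^+ 2 :> R by rewrite exprn_gt0 //; lra.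
apply: (@nonrep_choosable_of_sum R _ _ ((1 + eta / 2) * D%:R ^+ 2)).
  exact: mulr_gt0.
have -> : \sum_(0 <= t < #|G|) (t.+1 * D ^ t.*2.+1)%:R /
      ((1 + eta / 2) * D%:R ^+ 2) ^+ t =
    D%:R * \sum_(0 <= t < #|G|) t.+1%:R * q ^+ t.
  rewrite mulr_sumr; apply: eq_bigr => t _.
  rewrite natrM natrX exprMn -exprM mul2n exprS exprVn; field.
  by rewrite !lt0r_neq0 ?exprn_gt0 //; lra.
apply: ltW; apply: le_lt_trans (_ : B - 1 < _); last first.
  by rewrite ltrBlDr natr1; exact: truncnS_gt.
have := sum_arith_geometric #|G| q01.
move: (\sum_(0 <= t < _) _) => s le_s.
have : 2 * K < D%:R * eta by rewrite -ltr_pdivrMr.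
rewrite /B => D_eta.
have D_s : D%:R * s <= D%:R * (K - 1) by rewrite ler_wpM2l // /K addrK.
have D_K : D%:R * (2 * K) <= D%:R * (D%:R * eta) by rewrite ler_wpM2l // ltW.
by rewrite expr2; lra.
Qed.
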